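(* Let $c$ be an NNF constraint and let $\kappa$ be a refinement variable that is acyclic in $c$. Then $\mathrm{elim1}(\kappa,c)$ is satisfiable if and only if $c$ is satisfiable.
   Context: **Constraints.** Refinements $r$ are formulas over sorted variables in a fixed theory; the set $R$ of refinements is taken to contain equalities and be closed under $\wedge,\vee,\exists$. Each refinement variable $\kappa$ has a list $\mathrm{args}(\kappa)=\bar x$ of typed parameters. Predicates $p ::= r\mid\kappa(\bar y)\mid p\wedge p$ (solutions below also use $\vee,\exists$ over predicates). NNF constraints $c ::= p\mid c_1\wedge c_2\mid\forall x{:}b.\,p\Rightarrow c$ ($b$ a base type; $x$ is in scope in $p$ and $c$). A conjunction in goal (leaf) position is read as a conjunction of constraints, so each goal is one refinement or one application $\kappa(\bar y)$. Constraints are closed and well-sorted (every variable, including arguments of refinement variables, is in scope with the right sort); the variables bound by $\forall$ are pairwise distinct and distinct from all parameters, and parameters of different refinement variables are distinct. $\kappa\in c$ means that $\kappa$ occurs in $c$. **Assignments.** An assignment $\sigma$ maps refinement variables to refinements; it is partial if its values are predicates, and it leaves refinement variables outside its domain unchanged. $\sigma(\kappa)$ may mention, besides $\bar x=\mathrm{args}(\kappa)$, variables that refer by name to the binders enclosing the occurrences of $\kappa$. $\sigma(\kappa(\bar y))=\sigma(\kappa)[\bar y/\bar x]$, where the substitution never captures $\bar y$ (read it as ''let $\bar x=\bar y$ in $\sigma(\kappa)$''); $\sigma$ is extended homomorphically to predicates and constraints. $\sigma$ satisfies $c$, written $\sigma\models c$, if $\sigma(c)$ contains no refinement variable, is closed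 and well-sorted, and is logically valid. $c$ is satisfiable if $\sigma\models c$ for some assignment $\sigma$. **Acyclicity.** $\mathrm{flatten}(\mathit{true})=\emptyset$; $\mathrm{flatten}(p)=\{p\}$ for other goals; $\mathrm{flatten}(c\wedge c')=\mathrm{flatten}(c)\cup\mathrm{flatten}(c')$; $\mathrm{flatten}(\forall x{:}b.p\Rightarrow c)=\{\forall x{:}b.p\Rightarrow c'\mid c'\in\mathrm{flatten}(c)\}$. The head of a flat constraint $\forall x_1{:}b_1.p_1\Rightarrow\dots\Rightarrow\forall x_n{:}b_n.p_n\Rightarrow p$ is $p$, its body is $\{p_1,\dots,p_n\}$. $\kappa$ is acyclic in $c$ if no member of $\mathrm{flatten}(c)$ has $\kappa$ in both its head and its body. **Scope.** $\mathrm{scope}(\kappa,c_1\wedge c_2)$ is $\mathrm{scope}(\kappa,c_1)$ if $\kappa\in c_1,\kappa\notin c_2$, and $\mathrm{scope}(\kappa,c_2)$ if $\kappa\notin c_1,\kappa\in c_2$; $\mathrm{scope}(\kappa,\forall x{:}b.p\Rightarrow c')=\forall x{:}b.p\Rightarrow\mathrm{scope}(\kappa,c')$ if $\kappa\notin p$; in all other cases $\mathrm{scope}(\kappa,c)=c$. **Solutions.** $\mathrm{sol}(\kappa,c_1\wedge c_2)=\mathrm{sol}(\kappa,c_1)\vee\mathrm{sol}(\kappa,c_2)$; $\mathrm{sol}(\kappa,\forall x{:}b.p\Rightarrow c)=\exists x{:}b.\,p\wedge\mathrm{sol}(\kappa,c)$; $\mathrm{sol}(\kappa,\kappa(\bar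 y))=\bigwedge_i x_i=y_i$ with $\bar x=\mathrm{args}(\kappa)$; $\mathrm{sol}(\kappa,p)=\mathit{false}$ for other goals. Disjuncts equal to $\mathit{false}$ are dropped, and $p\wedge\mathit{false}$, $\exists x.\mathit{false}$ are simplified to $\mathit{false}$ (so a branch without $\kappa$ as goal contributes nothing). The scoped solution is $\hat\sigma_{c,\kappa}=[\kappa\mapsto\lambda\bar x.\,\mathrm{sol}(\kappa,c')]$, where $\mathrm{scope}(\kappa,c)=\forall x_1{:}b_1.p_1\Rightarrow\dots\Rightarrow\forall x_n{:}b_n.p_n\Rightarrow c'$, stripping the maximal prefix of implications with $\kappa\notin p_i$. **Elimination.** $\mathrm{elim}_\sigma(c_1\wedge c_2)=\mathrm{elim}_\sigma(c_1)\wedge\mathrm{elim}_\sigma(c_2)$; $\mathrm{elim}_\sigma(\forall x{:}b.p\Rightarrow c)=\forall x{:}b.\,\sigma(p)\Rightarrow\mathrm{elim}_\sigma(c)$; $\mathrm{elim}_\sigma(\kappa(\bar y))=\mathit{true}$ if $\kappa\in\mathrm{dom}(\sigma)$; $\mathrm{elim}_\sigma(p)=p$ for other goals. $\mathrm{elim1}(\kappa,c)=\mathrm{elim}_{\hat\sigma_{c,\kappa}}(c)$. *)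

(* Defs.v *)
From mathcomp Require Import all_boot.

Set Implicit Arguments.
Unset Strict Implicit.
Unset Printing Implicit Defensive.

Record signature := Signature {
  btype : eqType;
  fsym : Type;
  farity : fsym -> nat;
  fdom : forall f : fsym, 'I_(farity f) -> btype;
  fcod : fsym -> btype;
  rsym : Type;
  rarity : rsym -> nat;
  rdom : forall r : rsym, 'I_(rarity r) -> btype
}.

(* A variable is a name together with its sort: [(n, b)] is "x : b". *)
Definition var (S : signature) : eqType := (nat * btype S)%type.

Section Logic.
Variable S : signature.

(* Terms and formulas are raw; sorting is part of the judgements [term_ok] and
   [formula_ok] below. *)
Inductive term : Type :=
| tVar (x : var S)
| tApp (f : fsym S) (ts : 'I_(farity f) -> term).

Inductive formula : Type :=
| fTrue
| fFalse
| fEq (t u : term)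
| fRel (r : rsym S) (ts : 'I_(rarity r) -> term)
| fAnd (f g : formula)
| fOr (f g : formula)
| fImp (f g : formula)
| fEx (x : var S) (f : formula)
| fAll (x : var S) (f : formula).

Definition term_sort (t : term) : btype S :=
  match t with tVar x => x.2 | tApp f _ => fcod f end.

Fixpoint term_ok (G : seq (var S)) (t : term) : Prop :=
  match t with
  | tVar x => x \in G
  | tApp f ts => forall i, term_ok G (ts i) /\ term_sort (ts i) = fdom i
  end.

(* [formula_ok G f]: f is well-sorted and its free variables belong to G. *)
Fixpoint formula_ok (G : seq (var S)) (f : formula) : Prop :=
  match f with
  | fTrue | fFalse => True
  | fEq t u => [/\ term_ok G t, term_ok G u & term_sort t = term_sort u]
  | fRel r ts => forall i, term_ok G (ts i) /\ term_sort (ts i) = rdom i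
  | fAnd g h | fOr g h | fImp g h => formula_ok G g /\ formula_ok G h
  | fEx x g | fAll x g => formula_ok (x :: G) g
  end.

(* The carriers of a many-sorted structure are the fibres of [tag], so that raw
   terms can be evaluated; values of symbols at ill-sorted arguments are
   irrelevant. *)
Record structure := Structure {
  dom : Type;
  tag : dom -> btype S;
  dom_inhabited : forall b, exists d, tag d = b;
  finterp : forall f : fsym S, ('I_(farity f) -> dom) -> dom;
  finterp_tag : forall (f : fsym S) (ds : 'I_(farity f) -> dom),
    (forall i, tag (ds i) = fdom i) -> tag (finterp ds) = fcod f;
  rinterp : forall r : rsym S, ('I_(rarity r) -> dom) -> Prop
}.

(* A theory is given by its class of models, which need not be axiomatizable. *)
Definition theory := structure -> Prop.

Section Semantics.
Variable M : structure.

Definition env := var S -> dom M.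

Definition env_ok (rho : env) : Prop := forall x, tag (rho x) = x.2.

Definition upd (rho : env) (x : var S) (d : dom M) : env :=
  fun z => if z == x then d else rho z.

(* Simultaneous update: the value at the i-th element of xs becomes that of the
   i-th element of ys in rho. *)
Definition upd_let (rho : env) (xs ys : seq (var S)) : env :=
  fun z => nth (rho z) (map rho ys) (index z xs).

Fixpoint eval (rho : env) (t : term) : dom M :=
  match t with
  | tVar x => rho x
  | tApp f ts => finterp (fun i => eval rho (ts i))
  end.

Fixpoint fholds (rho : env) (f : formula) : Prop :=
  match f with
  | fTrue => True
  | fFalse => False
  | fEq t u => eval rho t = eval rho u
  | fRel r ts => rinterp (fun i => eval rho (ts i))
  | fAnd g h => fholds rho g /\ fholds rho h
  | fOr g h => fholds rho g \/ fholds rho h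
  | fImp g h => fholds rho g -> fholds rho h
  | fEx x g => exists d, tag d = x.2 /\ fholds (upd rho x d) g
  | fAll x g => forall d, tag d = x.2 -> fholds (upd rho x d) g
  end.

End Semantics.

(* [true] and [false] (the empty conjunction and disjunction) are required
   because elimination and solutions introduce them. *)
Record refinement_set (R : formula -> Prop) : Prop := RefinementSet {
  R_true : R fTrue;
  R_false : R fFalse;
  R_eq : forall t u, term_sort t = term_sort u -> R (fEq t u);
  R_and : forall f g, R f -> R g -> R (fAnd f g);
  R_or : forall f g, R f -> R g -> R (fOr f g);
  R_ex : forall x f, R f -> R (fEx x f)
}.

Record refinement_vars := RefinementVars {
  kvar :> eqType;
  args : kvar -> seq (var S);
  args_uniq : forall k, uniq (args k);
  args_disjoint : forall k k' x, x \in args k -> x \in args k' -> k = k'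
}.

End Logic.

Arguments fTrue {S}.
Arguments fFalse {S}.

Section Constraints.
Variables (S : signature) (K : refinement_vars S).

(* [pOr], [pEx] and [pLet] only occur in solutions.  [pLet xs ys p] is
   "let xs = ys in p", the capture-avoiding substitution p[ys/xs]. *)
Inductive predicate : Type :=
| pRef (f : formula S)
| pApp (k : K) (ys : seq (var S))
| pAnd (p q : predicate)
| pOr (p q : predicate)
| pEx (x : var S) (p : predicate)
| pLet (xs ys : seq (var S)) (p : predicate).

Inductive constraint : Type :=
| cGoal (p : predicate)
| cAnd (c d : constraint)
| cAll (x : var S) (p : predicate) (c : constraint).

Definition pTrue : predicate := pRef fTrue.
Definition pFalse : predicate := pRef fFalse.

Fixpoint pocc (k : K) (p : predicate) : bool :=
  match p with
  | pRef _ => false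
  | pApp k' _ => k' == k
  | pAnd q r | pOr q r => pocc k q || pocc k r
  | pEx _ q | pLet _ _ q => pocc k q
  end.

Fixpoint cocc (k : K) (c : constraint) : bool :=
  match c with
  | cGoal p => pocc k p
  | cAnd c1 c2 => cocc k c1 || cocc k c2
  | cAll _ p c' => pocc k p || cocc k c'
  end.

Fixpoint nnf_pred (R : formula S -> Prop) (p : predicate) : Prop :=
  match p with
  | pRef f => R f
  | pApp _ _ => True
  | pAnd q r => nnf_pred R q /\ nnf_pred R r
  | pOr _ _ | pEx _ _ | pLet _ _ _ => False
  end.

(* A conjunction in goal position is represented by [cAnd]. *)
Definition nnf_goal (R : formula S -> Prop) (p : predicate) : Prop :=
  match p with
  | pRef f => R f
  | pApp _ _ => True
  | _ => False
  end.

Fixpoint nnf (R : formula S -> Prop) (c : constraint) : Prop :=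
  match c with
  | cGoal p => nnf_goal R p
  | cAnd c1 c2 => nnf R c1 /\ nnf R c2
  | cAll _ p c' => nnf_pred R p /\ nnf R c'
  end.

(* [ys] can be substituted for [xs] where the variables in G are in scope. *)
Definition actuals_ok (G xs ys : seq (var S)) : Prop :=
  {subset ys <= G} /\ map snd ys = map snd xs.

Fixpoint pred_ok (G : seq (var S)) (p : predicate) : Prop :=
  match p with
  | pRef f => formula_ok G f
  | pApp k ys => actuals_ok G (args k) ys
  | pAnd q r | pOr q r => pred_ok G q /\ pred_ok G r
  | pEx x q => pred_ok (x :: G) q
  | pLet xs ys q => actuals_ok G xs ys /\ pred_ok (xs ++ G) q
  end.

Fixpoint constraint_ok (G : seq (var S)) (c : constraint) : Prop :=
  match c with
  | cGoal p => pred_ok G p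
  | cAnd c1 c2 => constraint_ok G c1 /\ constraint_ok G c2
  | cAll x p c' => pred_ok (x :: G) p /\ constraint_ok (x :: G) c'
  end.

Definition closed_well_sorted (c : constraint) : Prop := constraint_ok [::] c.

Fixpoint binders (c : constraint) : seq (var S) :=
  match c with
  | cGoal _ => [::]
  | cAnd c1 c2 => binders c1 ++ binders c2
  | cAll x _ c' => x :: binders c'
  end.

Record nnf_constraint (R : formula S -> Prop) (c : constraint) : Prop :=
  NnfConstraint {
  nnf_grammar : nnf R c;
  nnf_closed_well_sorted : closed_well_sorted c;
  nnf_binders_uniq : uniq (binders c);
  nnf_binders_args : forall x k, x \in binders c -> x \notin args (k : K)
}.

Section Validity.
Variable M : structure S.

(* The value at [pApp] is irrelevant: only predicates without refinement
   variables are tested for validity. *)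
Fixpoint pholds (rho : env M) (p : predicate) : Prop :=
  match p with
  | pRef f => fholds rho f
  | pApp _ _ => False
  | pAnd q r => pholds rho q /\ pholds rho r
  | pOr q r => pholds rho q \/ pholds rho r
  | pEx x q => exists d, tag d = x.2 /\ pholds (upd rho x d) q
  | pLet xs ys q => pholds (upd_let rho xs ys) q
  end.

Fixpoint cholds (rho : env M) (c : constraint) : Prop :=
  match c with
  | cGoal p => pholds rho p
  | cAnd c1 c2 => cholds rho c1 /\ cholds rho c2
  | cAll x p c' => forall d, tag d = x.2 ->
      pholds (upd rho x d) p -> cholds (upd rho x d) c'
  end.

End Validity.

Definition valid (T : theory S) (c : constraint) : Prop :=
  forall (M : structure S), T M ->
  forall rho : env M, env_ok rho -> cholds rho c.

(* The domain consists of the k such that [s k] is not [None]. *)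
Definition partial_assignment := K -> option predicate.

Definition assignment (R : formula S -> Prop) (s : partial_assignment) : Prop :=
  forall k p, s k = Some p -> exists2 f, R f & p = pRef f.

(* Binders are traversed without renaming: [s k] refers by name to the binders
   enclosing the occurrence of k. *)
Fixpoint psubst (s : partial_assignment) (p : predicate) : predicate :=
  match p with
  | pRef f => pRef f
  | pApp k ys => if s k is Some q then pLet (args k) ys q else pApp k ys
  | pAnd q r => pAnd (psubst s q) (psubst s r)
  | pOr q r => pOr (psubst s q) (psubst s r)
  | pEx x q => pEx x (psubst s q)
  | pLet xs ys q => pLet xs ys (psubst s q)
  end.

Fixpoint csubst (s : partial_assignment) (c : constraint) : constraint :=
  match c with
  | cGoal p => cGoal (psubst s p)
  | cAnd c1 c2 => cAnd (csubst s c1) (csubst s c2)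
  | cAll x p c' => cAll x (psubst s p) (csubst s c')
  end.

Definition satisfies (T : theory S) (s : partial_assignment) (c : constraint) :
    Prop :=
  [/\ forall k, ~~ cocc k (csubst s c),
      closed_well_sorted (csubst s c)
    & valid T (csubst s c)].

Definition satisfiable (T : theory S) (R : formula S -> Prop) (c : constraint) :
    Prop :=
  exists2 s : partial_assignment, assignment R s & satisfies T s c.

(* [(bs, p)] is the flat constraint whose implications are bs, outermost first,
   and whose head is p. *)
Definition flat_constraint := (seq (var S * predicate) * predicate)%type.

Fixpoint flatten (c : constraint) : seq flat_constraint :=
  match c with
  | cGoal (pRef fTrue) => [::]
  | cGoal p => [:: ([::], p)]
  | cAnd c1 c2 => flatten c1 ++ flatten c2
  | cAll x p c' => [seq ((x, p) :: f.1, f.2) | f <- flatten c']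
  end.

Definition head (f : flat_constraint) : predicate := f.2.
Definition body (f : flat_constraint) : seq predicate := map snd f.1.

Definition acyclic (k : K) (c : constraint) : bool :=
  all (fun f => ~~ (pocc k (head f) && has (pocc k) (body f))) (flatten c).

Fixpoint scope (k : K) (c : constraint) : constraint :=
  match c with
  | cGoal _ => c
  | cAnd c1 c2 =>
      if cocc k c1 && ~~ cocc k c2 then scope k c1
      else if ~~ cocc k c1 && cocc k c2 then scope k c2
      else c
  | cAll x p c' => if pocc k p then c else cAll x p (scope k c')
  end.

Fixpoint strip (k : K) (c : constraint) : constraint :=
  match c with
  | cAll _ p c' => if pocc k p then c else strip k c'
  | _ => c
  end.

Definition is_false (p : predicate) : bool :=
  if p is pRef fFalse then true else false.

(* With these, a branch without k as goal contributes nothing to [sol k];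
   in particular the solution of an acyclic k does not mention k. *)
Definition sOr (p q : predicate) : predicate :=
  if is_false p then q else if is_false q then p else pOr p q.
Definition sAnd (p q : predicate) : predicate :=
  if is_false q then pFalse else pAnd p q.
Definition sEx (x : var S) (p : predicate) : predicate :=
  if is_false p then pFalse else pEx x p.

Definition eqs (xs ys : seq (var S)) : predicate :=
  foldr pAnd pTrue [seq pRef (fEq (tVar e.1) (tVar e.2)) | e <- zip xs ys].

Fixpoint sol (k : K) (c : constraint) : predicate :=
  match c with
  | cGoal (pApp k' ys) => if k' == k then eqs (args k) ys else pFalse
  | cGoal _ => pFalse
  | cAnd c1 c2 => sOr (sol k c1) (sol k c2)
  | cAll x p c' => sEx x (sAnd p (sol k c'))
  end.

Definition scoped_sol (c : constraint) (k : K) : partial_assignment :=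
  fun k' => if k' == k then Some (sol k (strip k (scope k c))) else None.

Fixpoint elim (s : partial_assignment) (c : constraint) : constraint :=
  match c with
  | cGoal (pApp k ys) => if s k is Some _ then cGoal pTrue else c
  | cGoal _ => c
  | cAnd c1 c2 => cAnd (elim s c1) (elim s c2)
  | cAll x p c' => cAll x (psubst s p) (elim s c')
  end.

Definition elim1 (k : K) (c : constraint) : constraint :=
  elim (scoped_sol c k) c.

End Constraints.

(* Main.v *)
(** The solution of k is the strongest predicate satisfying the goals on k, and
    hypotheses are monotone in k. If s satisfies c, the solution therefore
    implies s k, and s itself satisfies the eliminated constraint. Scoping is
    harmless because s k must be well-sorted at every occurrence of k, so its
    free variables are bound above the subconstraint from which the solution is
    computed. Conversely, if s satisfies the eliminated constraint, the
    s-instance of the solution is equivalent to a refinement, and assigning it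
    to k satisfies c: at a goal k(ys), the current values of the variables bound
    on the path to it witness the existential quantifiers of the solution. *)

From Stdlib Require Import FunctionalExtensionality.
From mathcomp Require Import all_boot.
Require Import Defs.

Set Implicit Arguments.
Unset Strict Implicit.
Unset Printing Implicit Defensive.

(** * Well-sortedness in a context, and environments that agree on it *)

Section Semantics.
Variable S : signature.

Lemma term_ok_sub (G H : seq (var S)) t :
  {subset G <= H} -> term_ok G t -> term_ok H t.
Proof.
move=> sGH; elim: t => [x|f ts IH] /=; first exact: sGH.
by move=> ok i; have [/IH ? ?] := ok i.
Qed.

Lemma term_ok_meet (G H L : seq (var S)) t :
  (forall x, x \in G -> x \in H -> x \in L) ->
  term_ok G t -> term_ok H t -> term_ok L t.
Proof.
move=> sL; elim: t => [x|f ts IH] /=; first exact: sL.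
by move=> okG okH i; have [? ?] := okG i; have [? _] := okH i; split=> //; apply: IH.
Qed.

Lemma subset_cons (x : var S) (G H : seq (var S)) :
  {subset G <= H} -> {subset x :: G <= x :: H}.
Proof.
by move=> sGH z; rewrite !inE => /orP[->|/sGH ->] //; rewrite orbT.
Qed.

Lemma subset_catl (xs G H : seq (var S)) :
  {subset G <= H} -> {subset xs ++ G <= xs ++ H}.
Proof.
by move=> sGH z; rewrite !mem_cat => /orP[->|/sGH ->] //; rewrite orbT.
Qed.

Lemma meet_cons (x : var S) (G H L : seq (var S)) :
  (forall z, z \in G -> z \in H -> z \in L) ->
  forall z, z \in x :: G -> z \in x :: H -> z \in x :: L.
Proof.
move=> sL z; rewrite !inE; case: eqP => //= _; exact: sL.
Qed.

Lemma formula_ok_sub (G H : seq (var S)) f :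
  {subset G <= H} -> formula_ok G f -> formula_ok H f.
Proof.
elim: f G H => //=.
- by move=> t u G H /term_ok_sub sGH [/sGH ? /sGH ? ?].
- by move=> r ts G H /term_ok_sub sGH ok i; have [/sGH ? ?] := ok i.
- by move=> f IHf g IHg G H s [/(IHf _ _ s) ? /(IHg _ _ s) ?].
- by move=> f IHf g IHg G H s [/(IHf _ _ s) ? /(IHg _ _ s) ?].
- by move=> f IHf g IHg G H s [/(IHf _ _ s) ? /(IHg _ _ s) ?].
- by move=> x f IHf G H s; apply/IHf/subset_cons.
- by move=> x f IHf G H s; apply/IHf/subset_cons.
Qed.

(** The free variables lie in both contexts, and bound ones extend both alike. This locates the
    value of a refinement variable that occurs in two branches of a conjunction. *)
Lemma formula_ok_meet (G H L : seq (var S)) f :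
  (forall x, x \in G -> x \in H -> x \in L) ->
  formula_ok G f -> formula_ok H f -> formula_ok L f.
Proof.
elim: f G H L => //=.
- by move=> t u G H L s [? ? ?] [? ? _]; split=> //; apply: (term_ok_meet s).
- move=> r ts G H L s okG okH i; have [? ?] := okG i; have [? _] := okH i.
  by split=> //; apply: (term_ok_meet s).
- by move=> f IHf g IHg G H L s [? ?] [? ?]; split; [apply: (IHf G H)|apply: (IHg G H)].
- by move=> f IHf g IHg G H L s [? ?] [? ?]; split; [apply: (IHf G H)|apply: (IHg G H)].
- by move=> f IHf g IHg G H L s [? ?] [? ?]; split; [apply: (IHf G H)|apply: (IHg G H)].
- by move=> x f IHf G H L s; apply/IHf/meet_cons.
- by move=> x f IHf G H L s; apply/IHf/meet_cons.
Qed.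

Variable M : structure S.
Implicit Types rho : env M.

Definition agree (G : seq (var S)) rho rho' := {in G, rho =1 rho'}.

Lemma agree_sub G H rho rho' :
  {subset G <= H} -> agree H rho rho' -> agree G rho rho'.
Proof. by move=> s e z /s /e. Qed.

Lemma agree_trans G rho1 rho2 rho3 :
  agree G rho1 rho2 -> agree G rho2 rho3 -> agree G rho1 rho3.
Proof. by move=> e f z zG; rewrite e ?f. Qed.

Lemma agree_upd G rho rho' x d :
  agree G rho rho' -> agree (x :: G) (upd rho x d) (upd rho' x d).
Proof. by move=> e z; rewrite inE /upd; case: eqP => //= _ /e. Qed.

Lemma agree_upd_notin G rho x d : x \notin G -> agree G (upd rho x d) rho.
Proof. by move=> xG z zG; rewrite /upd; case: eqP xG => // <-; rewrite zG. Qed.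

Lemma upd_id rho x : upd rho x (rho x) = rho.
Proof. by apply: functional_extensionality => z; rewrite /upd; case: eqP => [->|]. Qed.

Lemma env_ok_upd rho x d : env_ok rho -> tag d = x.2 -> env_ok (upd rho x d).
Proof. by move=> ok dx z; rewrite /upd; case: eqP => [->|]. Qed.

Lemma upd_let_notin rho xs ys z :
  size ys = size xs -> z \notin xs -> upd_let rho xs ys z = rho z.
Proof.
by move=> sz zxs; rewrite /upd_let nth_default // size_map memNindex ?sz.
Qed.

Lemma agree_upd_let_notin G rho xs ys :
  size ys = size xs -> (forall z, z \in G -> z \notin xs) ->
  agree G (upd_let rho xs ys) rho.
Proof. by move=> sz dis z /dis; apply: upd_let_notin. Qed.

Lemma map_upd_let rho xs ys :
  uniq xs -> size ys = size xs -> map (upd_let rho xs ys) xs = map rho ys.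
Proof.
move=> ux sz; case: xs ux sz => [|x0 xs] ux sz; first by case: ys sz.
apply: (@eq_from_nth _ (rho x0)); first by rewrite !size_map.
rewrite size_map => i lti.
rewrite (nth_map x0) // /upd_let index_uniq //.
by apply: set_nth_default; rewrite size_map sz.
Qed.

Lemma actuals_size G (xs ys : seq (var S)) : actuals_ok G xs ys -> size ys = size xs.
Proof. by case=> _ e; rewrite -(size_map snd ys) e size_map. Qed.

Lemma actuals_ok_sub G H (xs ys : seq (var S)) :
  {subset G <= H} -> actuals_ok G xs ys -> actuals_ok H xs ys.
Proof. by move=> s [sy e]; split=> // z /sy /s. Qed.

Lemma agree_upd_let G rho rho' xs ys :
  actuals_ok G xs ys -> agree G rho rho' ->
  agree (xs ++ G) (upd_let rho xs ys) (upd_let rho' xs ys).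
Proof.
move=> act e z zG; have sz := actuals_size act.
have eys : map rho ys = map rho' ys.
  by apply/eq_in_map => y /act.1 /e.
case: (boolP (z \in xs)) => zxs.
  (* The two sides have different default values, which do not matter because [index z xs] is in
     range. *)
  by rewrite /upd_let eys; apply: set_nth_default; rewrite size_map sz index_mem.
rewrite !upd_let_notin //; apply: e.
by move: zG; rewrite mem_cat (negPf zxs).
Qed.

Lemma env_ok_upd_let G rho xs ys :
  actuals_ok G xs ys -> env_ok rho -> env_ok (upd_let rho xs ys).
Proof.
move=> act ok z; have sz := actuals_size act.
case: (boolP (z \in xs)) => zxs; last by rewrite upd_let_notin.
have lti : index z xs < size ys by rewrite sz index_mem.
rewrite /upd_let (nth_map z) // ok -(nth_map z z.2 snd) //.
by rewrite act.2 (nth_map z) ?index_mem // nth_index.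
Qed.

(** As [x] is not among [ys], setting it first does not affect the values read by the remaining
    updates. A simultaneous update can thus be expressed by one existential at a time. *)
Lemma upd_let_cons rho x xs y ys :
  size ys = size xs -> x \notin xs -> x \notin ys ->
  upd_let rho (x :: xs) (y :: ys) = upd_let (upd rho x (rho y)) xs ys.
Proof.
move=> sz xxs xys; apply: functional_extensionality => z.
have -> : upd_let (upd rho x (rho y)) xs ys z
    = nth (upd rho x (rho y) z) (map rho ys) (index z xs).
  rewrite /upd_let; congr nth; apply/eq_in_map => u uys.
  by rewrite /upd; case: eqP xys => // <-; rewrite uys.
rewrite /upd_let /= eq_sym /upd; case: eqP => //= ->.
by rewrite nth_default // size_map memNindex ?sz.
Qed.

Lemma eval_agree G rho rho' t :
  agree G rho rho' -> term_ok G t -> eval rho t = eval rho' t.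
Proof.
move=> e; elim: t => [x|f ts IH] /=; first exact: e.
move=> ok; congr finterp; apply: functional_extensionality => i.
by apply: IH; have [] := ok i.
Qed.

Lemma fholds_agree G rho rho' f :
  agree G rho rho' -> formula_ok G f -> fholds rho f <-> fholds rho' f.
Proof.
elim: f G rho rho' => //=.
- by move=> t u G rho rho' e [/(eval_agree e) -> /(eval_agree e) -> _].
- move=> r ts G rho rho' e ok.
  have -> // : (fun i => eval rho (ts i)) = (fun i => eval rho' (ts i)).
  by apply: functional_extensionality => i; apply: (eval_agree e); have [] := ok i.
- by move=> f IHf g IHg G rho rho' e [/(IHf _ _ _ e) ? /(IHg _ _ _ e) ?]; tauto.
- by move=> f IHf g IHg G rho rho' e [/(IHf _ _ _ e) ? /(IHg _ _ _ e) ?]; tauto.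
- by move=> f IHf g IHg G rho rho' e [/(IHf _ _ _ e) ? /(IHg _ _ _ e) ?]; tauto.
- move=> x f IHf G rho rho' e ok.
  by split=> -[d [dx h]]; exists d; split=> //;
    apply/(IHf _ _ _ (agree_upd d e) ok).
- move=> x f IHf G rho rho' e ok.
  by split=> h d dx; apply/(IHf _ _ _ (agree_upd d e) ok); apply: h.
Qed.

End Semantics.

(** * Predicates under substitution of assignments *)

Section Predicates.
Variables (S : signature) (K : refinement_vars S).
Implicit Types (p q : predicate K) (c : constraint K) (G H : seq (var S)).
Implicit Types s t : partial_assignment K.

Lemma pred_ok_sub G H p : {subset G <= H} -> pred_ok G p -> pred_ok H p.
Proof.
elim: p G H => /=.
- by move=> f G H s /(formula_ok_sub s).
- by move=> k ys G H s /(actuals_ok_sub s).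
- by move=> p IHp q IHq G H s [/(IHp _ _ s) ? /(IHq _ _ s) ?].
- by move=> p IHp q IHq G H s [/(IHp _ _ s) ? /(IHq _ _ s) ?].
- by move=> x p IHp G H s; apply/IHp/subset_cons.
- move=> xs ys p IHp G H s [/(actuals_ok_sub s) ? ?]; split=> //.
  exact: (IHp _ _ (subset_catl s)).
Qed.

Lemma pholds_agree (M : structure S) G (rho rho' : env M) p :
  agree G rho rho' -> pred_ok G p -> pholds rho p <-> pholds rho' p.
Proof.
elim: p G rho rho' => //=.
- by move=> f G rho rho'; apply: fholds_agree.
- by move=> f IHf g IHg G rho rho' e [/(IHf _ _ _ e) ? /(IHg _ _ _ e) ?]; tauto.
- by move=> f IHf g IHg G rho rho' e [/(IHf _ _ _ e) ? /(IHg _ _ _ e) ?]; tauto.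
- move=> x f IHf G rho rho' e ok.
  by split=> -[d [dx h]]; exists d; split=> //;
    apply/(IHf _ _ _ (agree_upd d e) ok).
- move=> xs ys p IHp G rho rho' e [act ok].
  exact: (IHp _ _ _ (agree_upd_let act e) ok).
Qed.

(** Structural form of the condition in [satisfies] that no refinement variable remains, convenient
    in inductions. *)
Fixpoint ground p : bool :=
  match p with
  | pRef _ => true
  | pApp _ _ => false
  | pAnd q r | pOr q r => ground q && ground r
  | pEx _ q | pLet _ _ q => ground q
  end.

Fixpoint cground c : bool :=
  match c with
  | cGoal p => ground p
  | cAnd c1 c2 => cground c1 && cground c2
  | cAll _ p c' => ground p && cground c'
  end.

Lemma groundP p : ground p <-> forall k, ~~ pocc k p.
Proof.
elim: p => //=.
- by move=> k ys; split=> // /(_ k); rewrite eqxx.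
- move=> p IHp q IHq; split=> [/andP[/IHp hp /IHq hq] k|h].
    by rewrite negb_or hp hq.
  by apply/andP; split; [apply/IHp|apply/IHq] => k; have := h k;
    rewrite negb_or => /andP[].
- move=> p IHp q IHq; split=> [/andP[/IHp hp /IHq hq] k|h].
    by rewrite negb_or hp hq.
  by apply/andP; split; [apply/IHp|apply/IHq] => k; have := h k;
    rewrite negb_or => /andP[].
Qed.

Lemma cgroundP c : cground c <-> forall k, ~~ cocc k c.
Proof.
elim: c => /=.
- exact: groundP.
- move=> p IHp q IHq; split=> [/andP[/IHp hp /IHq hq] k|h].
    by rewrite negb_or hp hq.
  by apply/andP; split; [apply/IHp|apply/IHq] => k; have := h k;
    rewrite negb_or => /andP[].
- move=> x p q IHq; split=> [/andP[/groundP hp /IHq hq] k|h].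
    by rewrite negb_or hp hq.
  by apply/andP; split; [apply/groundP|apply/IHq] => k; have := h k;
    rewrite negb_or => /andP[].
Qed.

(** * Changing the value of one refinement variable *)

Variable k : K.

Definition reassign s q : partial_assignment K :=
  fun k' => if k' == k then Some q else s k'.

Definition agree_off s t := forall k', k' != k -> s k' = t k'.

Lemma reassign_off s q : agree_off (reassign s q) s.
Proof. by move=> k' /negPf; rewrite /reassign => ->. Qed.

Lemma reassign_eq s q : reassign s q k = Some q.
Proof. by rewrite /reassign eqxx. Qed.

Lemma psubst_off s t p : agree_off s t -> ~~ pocc k p -> psubst s p = psubst t p.
Proof.
move=> st; elim: p => //=.
- by move=> k' ys /st ->.
- by move=> p IHp q IHq; rewrite negb_or => /andP[/IHp -> /IHq ->].
- by move=> p IHp q IHq; rewrite negb_or => /andP[/IHp -> /IHq ->].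
- by move=> x p IHp /IHp ->.
- by move=> xs ys p IHp /IHp ->.
Qed.

Lemma csubst_off s t c : agree_off s t -> ~~ cocc k c -> csubst s c = csubst t c.
Proof.
move=> st; elim: c => /=.
- by move=> p /(psubst_off st) ->.
- by move=> p IHp q IHq; rewrite negb_or => /andP[/IHp -> /IHq ->].
- by move=> x p q IHq; rewrite negb_or => /andP[/(psubst_off st) -> /IHq ->].
Qed.

(** Half of elimination: goals on [k] are trivialized, but hypotheses keep their occurrences of
    [k]. *)
Fixpoint discharge c : constraint K :=
  match c with
  | cGoal p => if p is pApp k' _ then
                 if k' == k then cGoal (pTrue K) else c
               else c
  | cAnd c1 c2 => cAnd (discharge c1) (discharge c2)
  | cAll x p c' => cAll x p (discharge c')
  end.

Lemma discharge_id c : ~~ cocc k c -> discharge c = c.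
Proof.
elim: c => /=.
- by case=> //= k' ys /negPf ->.
- by move=> p IHp q IHq; rewrite negb_or => /andP[/IHp -> /IHq ->].
- by move=> x p q IHq; rewrite negb_or => /andP[_ /IHq ->].
Qed.

Lemma constraint_ok_discharge G s c :
  constraint_ok G (csubst s c) -> constraint_ok G (csubst s (discharge c)).
Proof.
elim: c G => /=.
- by case=> // k' ys G; case: eqP.
- by move=> c IHc d IHd G [/IHc ? /IHd ?].
- by move=> x p c IHc G [? /IHc ?].
Qed.

Lemma cground_discharge s c :
  cground (csubst s c) -> cground (csubst s (discharge c)).
Proof.
elim: c => /=.
- by case=> // k' ys; case: eqP.
- by move=> c IHc d IHd /andP[/IHc -> /IHd ->].
- by move=> x p c IHc /andP[-> /IHc ->].
Qed.

Lemma psubst_psubst s q p :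
  psubst s (psubst (fun k' => if k' == k then Some q else None) p) =
  psubst (reassign s (psubst s q)) p.
Proof.
elim: p => //=.
- by move=> k' ys; rewrite /reassign; case: eqP => //= _.
- by move=> p -> r ->.
- by move=> p -> r ->.
- by move=> x p ->.
- by move=> xs ys p ->.
Qed.

(** Merging the solution with [s] reduces the theorem to comparing assignments that differ only at
    [k]. Goals are atomic by [nnf], so every goal that [elim] leaves unchanged is free of [k]. *)
Lemma csubst_elim R s q c : nnf R c ->
  csubst s (elim (fun k' => if k' == k then Some q else None) c) =
  csubst (reassign s (psubst s q)) (discharge c).
Proof.
elim: c => /=.
- by case=> //= k' ys _; rewrite /reassign; case: eqP => //= /eqP /negPf ->.
- by move=> c IHc d IHd [/IHc -> /IHd ->].
- by move=> x p c IHc [_ /IHc ->]; rewrite psubst_psubst.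
Qed.

Lemma ground_reassign s t q p :
  agree_off s t -> t k = Some q -> ground q ->
  ground (psubst s p) -> ground (psubst t p).
Proof.
move=> st tk gq; elim: p => //=.
- move=> k' ys; case: (eqVneq k' k) => [->|/st ->] //; by rewrite tk.
- by move=> p IHp r IHr /andP[/IHp -> /IHr ->].
- by move=> p IHp r IHr /andP[/IHp -> /IHr ->].
Qed.

Lemma cground_reassign s t q c :
  agree_off s t -> t k = Some q -> ground q ->
  cground (csubst s (discharge c)) -> cground (csubst t c).
Proof.
move=> st tk gq; elim: c => /=.
- case=> //= [k' ys|p r|p r|x p|xs ys p].
  + by case: (eqVneq k' k) => [->|/st /= ->] //=; rewrite tk.
  + exact: (ground_reassign (p := pAnd p r) st tk gq).
  + exact: (ground_reassign (p := pOr p r) st tk gq).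
  + exact: (ground_reassign st tk gq).
  + exact: (ground_reassign st tk gq).
- by move=> c IHc d IHd /andP[/IHc -> /IHd ->].
- by move=> x p c IHc /andP[/(ground_reassign st tk gq) -> /IHc ->].
Qed.

Lemma pred_ok_reassign s t q G0 G p :
  agree_off s t -> t k = Some q -> pred_ok (args k ++ G0) q ->
  {subset G0 <= G} -> pred_ok G p -> nnf_pred (fun _ => True) p ->
  pred_ok G (psubst s p) -> pred_ok G (psubst t p).
Proof.
move=> st tk okq sG; elim: p => //=.
- move=> k' ys; case: (eqVneq k' k) => [->|/st ->] // act _ _.
  by rewrite tk; split=> //; apply: (pred_ok_sub _ okq); apply: subset_catl.
- by move=> p IHp r IHr [? ?] [? ?] [? ?]; split; [apply: IHp|apply: IHr].
Qed.

Lemma nnf_pred_weaken R p : nnf_pred R p -> nnf_pred (fun _ => True) p.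
Proof. by elim: p => //= p IHp q IHq [/IHp ? /IHq ?]. Qed.

(** For the goals erased by [discharge], the actual parameters are well-sorted because [c] is.
    Besides [args k], the value [q] only needs variables of [G0], and these stay in scope under
    further binders. *)
Lemma constraint_ok_reassign R s t q G0 G c :
  agree_off s t -> t k = Some q -> pred_ok (args k ++ G0) q ->
  {subset G0 <= G} -> nnf R c -> constraint_ok G c ->
  constraint_ok G (csubst s (discharge c)) -> constraint_ok G (csubst t c).
Proof.
move=> st tk okq; elim: c G => /=.
- case=> //= k' ys G sG _; case: (eqVneq k' k) => [->|/st /= ->] //= act _.
  by rewrite tk; split=> //; apply: (pred_ok_sub _ okq); apply: subset_catl.
- by move=> c IHc d IHd G sG [? ?] [? ?] [? ?]; split; [apply: IHc|apply: IHd].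
- move=> x p c IHc G sG [np ?] [? ?] [? ?].
  have sxG : {subset G0 <= x :: G} by move=> z /sG zG; rewrite inE zG orbT.
  split; last exact: IHc.
  exact: (pred_ok_reassign st tk okq sxG _ (nnf_pred_weaken np)).
Qed.

(* Negation does not occur in hypotheses, so they are monotone in the value of k. *)
Lemma pholds_reassign (M : structure S) (rho : env M) s t q q' G p :
  agree_off s t -> s k = Some q -> t k = Some q' ->
  (forall ys, actuals_ok G (args k) ys ->
     pholds (upd_let rho (args k) ys) q -> pholds (upd_let rho (args k) ys) q') ->
  pred_ok G p -> nnf_pred (fun _ => True) p ->
  pholds rho (psubst s p) -> pholds rho (psubst t p).
Proof.
move=> st sk tk qq'; elim: p => //=.
- move=> k' ys; case: (eqVneq k' k) => [->|/st ->] // act _.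
  by rewrite sk tk; apply: qq'.
- by move=> p IHp r IHr [? ?] [? ?] [? ?]; split; [apply: IHp|apply: IHr].
Qed.

(** * Solutions under acyclicity, and the core of a constraint *)

Lemma is_falseP p : reflect (p = pFalse K) (is_false p).
Proof.
by apply: (iffP idP) => [|-> //]; case: p => //= -[].
Qed.

Lemma eqsP (M : structure S) (rho : env M) s xs ys : size ys = size xs ->
  pholds rho (psubst s (eqs K xs ys)) <-> map rho xs = map rho ys.
Proof.
rewrite /eqs; elim: xs ys => [|x xs IH] [|y ys] //= [/IH{}IH]; split.
  by move=> [-> /IH ->].
by case=> -> /IH.
Qed.

Lemma eqs_ok G s xs ys :
  {subset xs <= G} -> actuals_ok G xs ys -> pred_ok G (psubst s (eqs K xs ys)).
Proof.
rewrite /eqs; elim: xs ys => [|x xs IH] [|y ys] //= sx [sy [e es]]; split.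
  by split=> //; [apply: sx|apply: sy]; rewrite mem_head.
apply: IH; first by move=> z zx; apply: sx; rewrite inE zx orbT.
by split=> // z zy; apply: sy; rewrite inE zy orbT.
Qed.

Lemma eqs_noocc xs ys : ~~ pocc k (eqs K xs ys).
Proof. by rewrite /eqs; elim: (zip xs ys). Qed.

Lemma sol_no_head c :
  all (fun f => ~~ pocc k (head f)) (flatten c) -> sol k c = pFalse K.
Proof.
elim: c => /=.
- by case=> //= k' ys; rewrite andbT => /negPf ->.
- by move=> c IHc d IHd; rewrite all_cat => /andP[/IHc -> /IHd ->].
- by move=> x p c IHc; rewrite all_map => /IHc ->.
Qed.

Lemma acyclic_and c d :
  acyclic k (cAnd c d) = acyclic k c && acyclic k d.
Proof. by rewrite /acyclic /= all_cat. Qed.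

(** If [p] mentions [k], acyclicity keeps [k] out of every head in [c], and the simplifications make
    the solution literally false. Hence every hypothesis that survives in a solution is free of
    [k]. *)
Lemma acyclic_all x p c : acyclic k (cAll x p c) ->
  acyclic k c /\ (pocc k p -> sol k c = pFalse K).
Proof.
rewrite /acyclic /= all_map => h; split.
  apply: sub_all h => f /=; apply: contraNN => /andP[-> /=].
  by rewrite /body /= => ->; rewrite orbT.
move=> pk; apply: sol_no_head; apply: sub_all h => f /=.
by rewrite pk /= andbT.
Qed.

Lemma sol_noocc c : acyclic k c -> ~~ pocc k (sol k c).
Proof.
elim: c => /=.
- by case=> //= k' ys _; case: eqP => // _; apply: eqs_noocc.
- move=> c IHc d IHd; rewrite acyclic_and => /andP[/IHc ? /IHd ?].
  by rewrite /sOr; case: ifP => // _; case: ifP => //= _; rewrite negb_or; apply/andP.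
- move=> x p c IHc /acyclic_all[/IHc ? pk]; rewrite /sEx /sAnd.
  case: (is_falseP (sol k c)) => //= ns; rewrite negb_or; apply/andP; split=> //.
  by apply/negP => /pk.
Qed.

Lemma sol_cocc c : ~~ cocc k c -> sol k c = pFalse K.
Proof.
elim: c => /=.
- by case=> //= k' ys /negPf ->.
- by move=> c IHc d IHd; rewrite negb_or => /andP[/IHc -> /IHd ->].
- by move=> x p c IHc; rewrite negb_or => /andP[_ /IHc ->].
Qed.

Lemma pholds_sol_and (M : structure S) (rho : env M) s c d :
  pholds rho (psubst s (sol k (cAnd c d))) <->
  pholds rho (psubst s (sol k c)) \/ pholds rho (psubst s (sol k d)).
Proof.
rewrite /= /sOr; case: is_falseP => [->|_] /=; first by tauto.
by case: is_falseP => [->|_] /=; tauto.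
Qed.

Lemma pholds_sol_all (M : structure S) (rho : env M) s x p c :
  pholds rho (psubst s (sol k (cAll x p c))) <->
  exists d, [/\ tag d = x.2, pholds (upd rho x d) (psubst s p)
              & pholds (upd rho x d) (psubst s (sol k c))].
Proof.
rewrite /= /sEx /sAnd; case: (is_falseP (sol k c)) => [->|_] /=.
  by split=> // -[d []].
split=> [[d [dx [? ?]]]|[d [dx ? ?]]]; first by exists d.
by exists d; split.
Qed.

Lemma sol_and_ok H s c d :
  pred_ok H (psubst s (sol k c)) -> pred_ok H (psubst s (sol k d)) ->
  pred_ok H (psubst s (sol k (cAnd c d))).
Proof. by rewrite /= /sOr; case: ifP => // _; case: ifP. Qed.

Lemma pocc_unassigned s p : s k = None -> ground (psubst s p) -> ~~ pocc k p.
Proof.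
move=> sk; elim: p => //=.
- by move=> k' ys; case: eqP => // ->; rewrite sk.
- by move=> p IHp r IHr /andP[/IHp pk /IHr]; rewrite negb_or pk.
- by move=> p IHp r IHr /andP[/IHp pk /IHr]; rewrite negb_or pk.
Qed.

Lemma cocc_unassigned s c : s k = None -> cground (csubst s c) -> ~~ cocc k c.
Proof.
move=> sk; elim: c => /=.
- by move=> p; apply: pocc_unassigned.
- by move=> c IHc d IHd /andP[/IHc ck /IHd]; rewrite negb_or ck.
- by move=> x p c IHc /andP[/(pocc_unassigned sk) pk /IHc]; rewrite negb_or pk.
Qed.

(** A single recursion in place of [scope] followed by [strip] (see [strip_scope]); [core_ctx]
    collects in parallel the variables in scope at the core. *)
Fixpoint core c : constraint K :=
  match c with
  | cGoal _ => c
  | cAnd c1 c2 =>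
      if cocc k c1 && ~~ cocc k c2 then core c1
      else if ~~ cocc k c1 && cocc k c2 then core c2
      else c
  | cAll x p c' => if pocc k p then c else core c'
  end.

Fixpoint core_ctx G c : seq (var S) :=
  match c with
  | cGoal _ => G
  | cAnd c1 c2 =>
      if cocc k c1 && ~~ cocc k c2 then core_ctx G c1
      else if ~~ cocc k c1 && cocc k c2 then core_ctx G c2
      else G
  | cAll x p c' => if pocc k p then G else core_ctx (x :: G) c'
  end.

Lemma strip_scope c : strip k (scope k c) = core c.
Proof.
elim: c => //=; first by move=> c IHc d IHd; case: ifP => // _; case: ifP.
by move=> x p c IHc; case: ifP => /= pk; rewrite pk.
Qed.

Lemma core_descend (Q : seq (var S) -> constraint K -> Prop) G c :
  (forall G c d, Q G (cAnd c d) -> Q G c /\ Q G d) ->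
  (forall G x p c, Q G (cAll x p c) -> Q (x :: G) c) ->
  Q G c -> Q (core_ctx G c) (core c).
Proof.
move=> QA Qall; elim: c G => //=.
- move=> c IHc d IHd G q; have [qc qd] := QA _ _ _ q.
  by case: ifP => _; [apply: IHc|case: ifP => _ //; apply: IHd].
- by move=> x p c IHc G q; case: ifP => // _; apply/IHc/(Qall _ _ p).
Qed.

(** The conjuncts and hypotheses skipped on the way to the core are free of [k], so the change at
    [k] has to be examined at the core only. *)
Lemma core_lift (Q : seq (var S) -> constraint K -> Prop) G c :
  (forall G c, ~~ cocc k c -> Q G c) ->
  (forall G c d, Q G c -> Q G d -> Q G (cAnd c d)) ->
  (forall G x p c, ~~ pocc k p -> Q (x :: G) c -> Q G (cAll x p c)) ->
  Q (core_ctx G c) (core c) -> Q G c.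
Proof.
move=> Q0 QA Qall; elim: c G => //=.
- move=> c IHc d IHd G; case: ifP => [/andP[_ /Q0 ?] /IHc ?|_]; first exact: QA.
  by case: ifP => // /andP[/Q0 ? _] /IHd ?; apply: QA.
- by move=> x p c IHc G; case: ifPn => // pk /IHc; apply: Qall.
Qed.

End Predicates.

(** * Predicates equivalent to refinements *)

Section Expressible.
Variables (S : signature) (R : formula S -> Prop) (hR : refinement_set R).
Variable K : refinement_vars S.
Implicit Types (p q : predicate K) (G : seq (var S)).

(** Assignments take values in [R], whereas an instance of a solution is only a predicate. One [f]
    serves all contexts and models. Environments must respect sorts because the value of an actual
    parameter will witness a sorted quantifier. *)
Definition expressible p : Prop := exists f, [/\ R f,
  forall G, pred_ok G p -> formula_ok G f &
  forall (M : structure S) (rho : env M), env_ok rho ->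
    pholds rho p <-> fholds rho f].

Lemma expressible_ref f : R f -> expressible (pRef K f).
Proof. by move=> Rf; exists f; split. Qed.

Lemma expressible_and p q :
  expressible p -> expressible q -> expressible (pAnd p q).
Proof.
move=> [f [Rf okf ef]] [g [Rg okg eg]]; exists (fAnd f g); split.
- exact: R_and.
- by move=> G /= [/okf ? /okg ?].
- by move=> M rho ok /=; have := ef M rho ok; have := eg M rho ok; tauto.
Qed.

Lemma expressible_or p q :
  expressible p -> expressible q -> expressible (pOr p q).
Proof.
move=> [f [Rf okf ef]] [g [Rg okg eg]]; exists (fOr f g); split.
- exact: R_or.
- by move=> G /= [/okf ? /okg ?].
- by move=> M rho ok /=; have := ef M rho ok; have := eg M rho ok; tauto.
Qed.

Lemma expressible_ex x p : expressible p -> expressible (pEx x p).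
Proof.
move=> [f [Rf okf ef]]; exists (fEx x f); split.
- exact: R_ex.
- by move=> G /= /okf.
- move=> M rho ok /=.
  by split=> -[d [dx h]]; exists d; split=> //; apply/ef => //; apply: env_ok_upd.
Qed.

(* R need not be closed under substitution, so "let xs = ys in f" is expressed
   as "exists xs, xs = ys /\ f", which is correct since ys avoids xs. *)
Lemma expressible_let xs ys f :
  R f -> uniq xs -> map snd ys = map snd xs ->
  (forall y, y \in ys -> y \notin xs) -> expressible (pLet xs ys (pRef K f)).
Proof.
move=> Rf; rewrite /expressible /=.
elim: xs ys => [|x xs IH] [|y ys] //=.
  move=> _ _ _; exists f; split=> [|G []|M rho _]; [by []..|].
  have -> // : upd_let rho [::] [::] = rho.
  by apply: functional_extensionality => z; rewrite /upd_let nth_nil.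
move=> /andP[xxs uxs] [exy es] dis.
have xys : x \notin ys.
  by apply: contraL (mem_head x xs) => xys; apply: dis; rewrite inE xys orbT.
have yx : (y == x) = false.
  by have := dis y (mem_head y ys); rewrite inE negb_or => /andP[/negPf].
have sz : size ys = size xs by rewrite -(size_map snd ys) es size_map.
have [|g [Rg okg eg]] := IH ys uxs es.
  by move=> z zys; have := dis z; rewrite !inE zys orbT negb_or => /(_ isT) /andP[].
exists (fEx x (fAnd (fEq (tVar x) (tVar y)) g)); split.
- by apply: (R_ex hR); apply: (R_and hR) => //; apply: (R_eq hR).
- move=> G [[sy _] okf] /=; split.
    by split=> //=; rewrite inE ?eqxx // sy ?orbT // mem_head.
  apply: okg; split.
    by split=> // z zys; rewrite inE sy ?orbT // inE zys orbT.
  apply: formula_ok_sub okf => z.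
  by rewrite !(inE, mem_cat) => /orP[->|/orP[->|->]]; rewrite ?orbT.
- move=> M rho ok; rewrite upd_let_cons //.
  have /eg{}eg : env_ok (upd rho x (rho y)) by apply: env_ok_upd => //; rewrite ok.
  split=> [/eg h|/= [d [_ []]]].
    exists (rho y); split; first by rewrite ok.
    by split=> //=; rewrite /upd eqxx yx.
  by rewrite {1 2}/upd eqxx yx => -> /eg.
Qed.

(** Actual parameters come from [G], which is disjoint from all formal parameters, so
    [expressible_let] applies to each application. *)
Lemma expressible_psubst s G p :
  assignment R s -> nnf_pred R p -> pred_ok G p ->
  (forall x k, x \in G -> x \notin args (k : K)) ->
  ground (psubst s p) -> expressible (psubst s p).
Proof.
move=> hs np okp dis; elim: p np okp => //=.
- by move=> f Rf _ _; apply: expressible_ref.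
- move=> k ys _ [sy es]; case sk: (s k) => [q|] //= _.
  have [f Rf ->] := hs _ _ sk.
  apply: expressible_let => //; first exact: args_uniq.
  by move=> y /sy; apply: dis.
- move=> p IHp q IHq [? ?] [? ?] /andP[? ?].
  by apply: expressible_and; [apply: IHp|apply: IHq].
Qed.

Lemma expressible_eqs s xs ys :
  map snd ys = map snd xs -> expressible (psubst s (eqs K xs ys)).
Proof.
rewrite /eqs; elim: xs ys => [|x xs IH] [|y ys] //=.
- by move=> _; apply: expressible_ref; apply: (R_true hR).
- move=> [exy /IH h]; apply: expressible_and => //.
  by apply: expressible_ref; apply: (R_eq hR).
Qed.

End Expressible.

(** * Comparing assignments on a constraint and on its discharged form *)

Section Elimination.
Variables (S : signature) (R : formula S -> Prop) (K : refinement_vars S) (k : K).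
Implicit Types (c d : constraint K) (G : seq (var S)) (s t : partial_assignment K).

(** The assumptions of the theorem, relative to a context of enclosing binders so that they pass to
    subconstraints. *)
Record scoped G c : Prop := Scoped {
  scoped_nnf : nnf R c;
  scoped_ok : constraint_ok G c;
  scoped_acyclic : acyclic k c;
  scoped_uniq : uniq (binders c);
  scoped_fresh : forall x, x \in binders c -> x \notin G;
  scoped_args : forall x k', x \in binders c ++ G -> x \notin args (k' : K)
}.

Lemma scoped_and G c d : scoped G (cAnd c d) -> scoped G c /\ scoped G d.
Proof.
case=> -[nc nd] [okc okd]; rewrite acyclic_and => /andP[ac ad] /=.
rewrite cat_uniq => /and3P[uc _ ud] fr ar.
split; split=> // x.
- by move=> xc; apply: fr; rewrite mem_cat xc.
- by move=> k' xc; apply: ar; move: xc; rewrite !mem_cat => /orP[->|->]; rewrite ?orbT.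
- by move=> xc; apply: fr; rewrite mem_cat xc orbT.
- by move=> k' xc; apply: ar; move: xc; rewrite !mem_cat => /orP[->|->]; rewrite ?orbT.
Qed.

Lemma scoped_all G x p c : scoped G (cAll x p c) -> scoped (x :: G) c.
Proof.
case=> -[_ nc] [_ okc] /acyclic_all[ac _] /= /andP[xc uc] fr ar.
split=> // z.
- move=> zc; rewrite inE negb_or fr ?inE ?zc ?orbT // andbT.
  by apply: contraNneq xc => <-.
- move=> k' zc; apply: ar; move: zc; rewrite !(inE, mem_cat).
  by move=> /orP[->|/orP[->|->]]; rewrite ?orbT.
Qed.

Lemma scoped_ctx G c z : scoped G c -> z \in G -> z \notin args k.
Proof. by move=> sc zG; apply: (scoped_args sc); rewrite mem_cat zG orbT. Qed.

Lemma scoped_binder G x p c : scoped G (cAll x p c) -> x \notin G /\ x \notin args k.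
Proof.
move=> sc; split; first by apply: (scoped_fresh sc); rewrite mem_head.
by apply: (scoped_args sc); rewrite mem_head.
Qed.

(** The hypotheses kept in the solution are free of [k], so [s] and [t] give them the same
    instances. The theorem uses this with [t] assigning to [k] the solution itself. *)
Lemma sol_ok s t G H c :
  agree_off k s t -> acyclic k c -> {subset args k ++ G <= H} ->
  constraint_ok G c -> constraint_ok G (csubst t (discharge k c)) ->
  pred_ok H (psubst s (sol k c)).
Proof.
move=> st; elim: c G H => /=.
- case=> //= k' ys G H _ sH act _; case: eqP act => // -> act.
  apply: eqs_ok => [z zk|]; first by apply: sH; rewrite mem_cat zk.
  by apply: actuals_ok_sub act => z zG; apply: sH; rewrite mem_cat zG orbT.
- move=> c IHc d IHd G H; rewrite acyclic_and => /andP[ac ad] sH [? ?] [? ?].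
  by apply: sol_and_ok; [apply: IHc sH _ _|apply: IHd sH _ _].
- move=> x p c IHc G H /acyclic_all[ac pk] sH [okp okc] [okp' okc'].
  rewrite /sEx /sAnd; case: (is_falseP (sol k c)) => //= ns.
  have npk : ~~ pocc k p by apply/negP => /pk.
  have sxH : {subset args k ++ x :: G <= x :: H}.
    move=> z; rewrite mem_cat !inE orbCA => /orP[-> //|zG].
    by rewrite sH ?orbT // mem_cat.
  split; last exact: IHc sxH _ _.
  rewrite (psubst_off st npk); apply: pred_ok_sub okp' => z zG.
  by apply: sxH; rewrite mem_cat zG orbT.
Qed.

Lemma sol_ground s t c :
  agree_off k s t -> acyclic k c -> cground (csubst t (discharge k c)) ->
  ground (psubst s (sol k c)).
Proof.
move=> st; elim: c => /=.
- case=> //= k' ys _ _; case: eqP => // _.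
  by rewrite /eqs; elim: (zip _ _).
- move=> c IHc d IHd; rewrite acyclic_and => /andP[ac ad] /andP[gc gd].
  rewrite /sOr; case: ifP => _; first exact: IHd.
  by case: ifP => _; [apply: IHc|apply/andP; split; [apply: IHc|apply: IHd]].
- move=> x p c IHc /acyclic_all[ac pk] /andP[gp gc].
  rewrite /sEx /sAnd; case: (is_falseP (sol k c)) => //= ns.
  rewrite IHc // andbT (psubst_off st) //; apply/negP => /pk //.
Qed.

Lemma sol_expressible (hR : refinement_set R) s t G c :
  assignment R s -> agree_off k s t -> scoped G c ->
  cground (csubst t (discharge k c)) -> expressible R (psubst s (sol k c)).
Proof.
move=> hs st; have eF := expressible_ref K (R_false hR).
elim: c G => /=.
- case=> //= k' ys G sc _; case: eqP => // e.
  by apply: expressible_eqs => //; have [_] := scoped_ok sc; rewrite e.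
- move=> c IHc d IHd G /scoped_and[/IHc hc /IHd hd] /andP[/hc ? /hd ?].
  by rewrite /sOr; case: ifP => // _; case: ifP => // _; apply: expressible_or.
- move=> x p c IHc G sc /andP[gp gc].
  have [_ pk] := acyclic_all (scoped_acyclic sc).
  rewrite /sEx /sAnd; case: (is_falseP (sol k c)) => //= ns.
  have npk : ~~ pocc k p by apply/negP => /pk.
  have scx := scoped_all sc.
  apply/expressible_ex/expressible_and => //; last exact: IHc scx _.
  rewrite -(psubst_off st npk) in gp.
  apply: (expressible_psubst hR hs (scoped_nnf sc).1 (scoped_ok sc).1) => // z k' zG.
  by apply: (scoped_args scx); rewrite mem_cat zG orbT.
Qed.

(* An assignment implied by the solution satisfies the discharged goals: a
   variable bound on the path to a goal k(ys) is its own witness in [sol]. *)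
Lemma cholds_of_discharge (M : structure S) (rho : env M) t t' q q' G c :
  agree_off k t t' -> t k = Some q -> t' k = Some q' ->
  (forall rho' : env M, env_ok rho' -> pholds rho' q' -> pholds rho' q) ->
  scoped G c -> constraint_ok G (csubst t (discharge k c)) -> env_ok rho ->
  (forall rho' : env M, env_ok rho' -> agree G rho' rho ->
     pholds rho' (psubst t (sol k c)) -> pholds rho' q') ->
  cholds rho (csubst t (discharge k c)) -> cholds rho (csubst t' c).
Proof.
move=> tt' tk t'k q'q; elim: c G rho => /=.
- move=> p G rho sc; have := scoped_nnf sc; case: p sc => //= k' ys sc _ _ ok.
  case: (eqVneq k' k) => [e|/tt' /= ->] //.
  have act := scoped_ok sc; rewrite /= e in act.
  have sz := actuals_size act.
  (* Binding [args k], which is disjoint from [G], leaves the values of [ys] unchanged, so the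
     equations of the solution hold in the updated environment. *)
  rewrite e t'k /= => h _; apply: h.
  + exact: env_ok_upd_let act ok.
  + by apply: agree_upd_let_notin => // z; apply: scoped_ctx sc.
  + apply/eqsP => //; rewrite map_upd_let ?args_uniq //.
    apply/esym/eq_in_map => y /act.1 yG.
    by apply: upd_let_notin => //; apply: scoped_ctx sc yG.
- move=> c IHc d IHd G rho /scoped_and[scc scd] [okc okd] ok h [hc hd].
  split; [apply: IHc scc _ _ _ _|apply: IHd scd _ _ _ _] => // rho' ok' e hs.
    by apply: h => //; apply/pholds_sol_and; left.
  by apply: h => //; apply/pholds_sol_and; right.
- move=> x p c IHc G rho sc [okp okc] ok h hc d dx hp.
  have scx := scoped_all sc; have [_ pk] := acyclic_all (scoped_acyclic sc).
  have okx := env_ok_upd ok dx.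
  (* Since [q'] implies [q], monotonicity carries the hypothesis from [t'] back to [t]. *)
  have hp' : pholds (upd rho x d) (psubst t p).
    have t't : agree_off k t' t by move=> z /tt' ->.
    apply: (pholds_reassign t't t'k tk _ (scoped_ok sc).1) hp => [ys act|].
      by apply: q'q; apply: env_ok_upd_let act okx.
    exact: nnf_pred_weaken (scoped_nnf sc).1.
  apply: IHc scx _ _ _ (hc d dx hp') => // rho' ok' e hs.
  have xG := (scoped_binder sc).1.
  apply: h => //.
    apply: (agree_trans (agree_sub _ e)); last exact: agree_upd_notin.
    by move=> z zG; rewrite inE zG orbT.
  apply/pholds_sol_all; exists (rho' x); rewrite upd_id; split=> //.
  exact/(pholds_agree e okp).
Qed.

(** The solution is followed down to a goal on [k]. There its equations make [rho'] agree with the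
    environment of the instantiated goal on [args k ++ G0], which contains the free variables of
    [q]. Witnesses chosen on the way can be forgotten, as their binders lie outside that list.
    Agreement of [rho'] with [rho] only on [G] leaves the formal parameters free. *)
Lemma pholds_sol_strongest (M : structure S) (rho rho' : env M) s q G0 G c :
  s k = Some q -> pred_ok (args k ++ G0) q -> {subset G0 <= G} ->
  scoped G c -> constraint_ok G (csubst s c) ->
  agree G rho' rho -> cholds rho (csubst s c) ->
  pholds rho' (psubst s (sol k c)) -> pholds rho' q.
Proof.
move=> sk okq; elim: c G rho rho' => /=.
- case=> //= k' ys G rho rho' sG sc; case: (eqVneq k' k) => //= e _.
  have act := scoped_ok sc; rewrite /= e in act; rewrite e sk /=.
  have sz := actuals_size act.
  move=> agr h /(eqsP _ _ sz) ex.
  suff e' : agree (args k ++ G0) rho' (upd_let rho (args k) ys).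
    exact/(pholds_agree e' okq).
  move=> z; rewrite mem_cat.
  have exy : map rho' (args k) = map (upd_let rho (args k) ys) (args k).
    rewrite map_upd_let ?args_uniq // ex.
    by apply/eq_in_map => y /act.1 /agr.
  move/eq_in_map: exy => exy; case: (boolP (z \in args k)) => [/exy -> //|zk /= /sG zG].
  by rewrite upd_let_notin // agr.
- move=> c IHc d IHd G rho rho' sG /scoped_and[scc scd] [okc okd] agr [hc hd].
  by case/pholds_sol_and; [exact: IHc sG scc okc agr hc|exact: IHd sG scd okd agr hd].
- move=> x p c IHc G rho rho' sG sc [okp okc] agr hc /pholds_sol_all[d [dx hp hs]].
  have agrx := agree_upd (x := x) d agr.
  have hp' := (pholds_agree agrx okp).1 hp.
  have [xG xk] := scoped_binder sc.
  have sxG : {subset G0 <= x :: G} by move=> z /sG zG; rewrite inE zG orbT.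
  have hq := IHc _ _ _ sxG (scoped_all sc) okc agrx (hc d dx hp') hs.
  have xq : x \notin args k ++ G0.
    by rewrite mem_cat negb_or xk; apply: contra xG => /sG.
  exact/(pholds_agree (agree_upd_notin rho' d xq) okq).
Qed.

(** Goals on [k] become true, and the stronger value [q] makes hypotheses stronger by monotonicity.
    The implication is required in all environments that agree on [G0], since binders and formal
    parameters only change variables outside it. *)
Lemma cholds_discharge (M : structure S) (rho : env M) s t q q' G0 G c :
  agree_off k t s -> t k = Some q -> s k = Some q' -> {subset G0 <= G} ->
  scoped G c ->
  (forall rho' : env M, agree G0 rho' rho -> pholds rho' q -> pholds rho' q') ->
  cholds rho (csubst s c) -> cholds rho (csubst t (discharge k c)).
Proof.
move=> ts tk sk; elim: c G rho => /=.
- move=> p G rho _ sc; have := scoped_nnf sc; case: p sc => //= k' ys _ _ _.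
  by case: (eqVneq k' k) => //= /ts ->.
- move=> c IHc d IHd G rho sG /scoped_and[scc scd] h [hc hd].
  by split; [apply: IHc scc h hc|apply: IHd scd h hd].
- move=> x p c IHc G rho sG sc h hc d dx hp.
  have [xG _] := scoped_binder sc; have scx := scoped_all sc.
  have sxG : {subset G0 <= x :: G} by move=> z /sG zG; rewrite inE zG orbT.
  have xG0 : x \notin G0 by apply: contra xG => /sG.
  have h' rho' : agree G0 rho' (upd rho x d) -> pholds rho' q -> pholds rho' q'.
    by move=> e; apply: h; apply: (agree_trans e); apply: agree_upd_notin.
  apply: (IHc _ _ sxG scx h'); apply: hc => //.
  apply: (pholds_reassign ts tk sk _ (scoped_ok sc).1) hp => [ys act|].
    apply: h'; apply: agree_upd_let_notin; first exact: actuals_size act.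
    by move=> z /sxG; apply: scoped_ctx scx.
  exact: nnf_pred_weaken (scoped_nnf sc).1.
Qed.

Lemma pocc_ok s q G p : s k = Some q -> nnf_pred (fun _ => True) p -> pocc k p ->
  pred_ok G (psubst s p) -> pred_ok (args k ++ G) q.
Proof.
move=> sk; elim: p => //=.
- by move=> k' ys _ /eqP ->; rewrite sk => -[].
- by move=> p IHp r IHr [? ?] /orP[?|?] [? ?]; [apply: IHp|apply: IHr].
Qed.

(** An occurrence of [k] becomes a [pLet] with body [q], which must be well-sorted there; the
    binders crossed to reach it are among [binders c]. *)
Lemma cocc_ok s q G c : s k = Some q -> nnf R c -> cocc k c ->
  constraint_ok G (csubst s c) -> pred_ok (args k ++ binders c ++ G) q.
Proof.
move=> sk; elim: c G => /=.
- by case=> //= k' ys G _ /eqP ->; rewrite sk => -[].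
- move=> c IHc d IHd G [nc nd] /orP[oc|od] [okc okd].
    apply: (pred_ok_sub _ (IHc _ nc oc okc)) => z.
    by rewrite !mem_cat => /or3P[->|->|->]; rewrite ?orbT.
  apply: (pred_ok_sub _ (IHd _ nd od okd)) => z.
  by rewrite !mem_cat => /or3P[->|->|->]; rewrite ?orbT.
- move=> x p c IHc G [np nc] /orP[op|oc] [okp okc].
    apply: (pred_ok_sub _ (pocc_ok sk (nnf_pred_weaken np) op okp)) => z.
    by rewrite !(inE, mem_cat) => /or3P[->|->|->]; rewrite ?orbT.
  apply: (pred_ok_sub _ (IHc _ nc oc okc)) => z.
  by rewrite !(inE, mem_cat) => /orP[->|/or3P[->|->|->]]; rewrite ?orbT.
Qed.

(* If k occurs in both branches of a conjunction, the free variables of its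
   value are in scope in both branches, hence at the conjunction. *)
Lemma core_scope s f G c :
  s k = Some (pRef K f) -> scoped G c -> constraint_ok G (csubst s c) ->
  sol k (core k c) = pFalse K \/
  pred_ok (args k ++ core_ctx k G c) (pRef K f).
Proof.
move=> sk; elim: c G => /=.
- case=> [f'|k' ys|p q|p q|x p|xs ys p] G sc; rewrite /=; try by left.
  by case: eqP => [->|_]; [rewrite sk => -[]; right|left].
- move=> c IHc d IHd G sc [okc okd]; have [scc scd] := scoped_and sc.
  case: ifP => [_|]; first exact: IHc.
  case: ifP => [_ _|]; first exact: IHd.
  case oc: (cocc k c); case od: (cocc k d) => //= _ _.
    right; have ok1 := cocc_ok sk (scoped_nnf scc) oc okc.
    have ok2 := cocc_ok sk (scoped_nnf scd) od okd.
    apply: formula_ok_meet ok1 ok2 => z; rewrite !mem_cat.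
    case/or3P=> [->//|zc|->]; last by rewrite orbT.
    case/or3P=> [->//|zd|->]; last by rewrite orbT.
    (* A variable bound in both branches would contradict the distinctness of binders. *)
    have := scoped_uniq sc; rewrite /= cat_uniq => /and3P[_ /hasP[]].
    by exists z.
  by left; rewrite !sol_cocc ?oc ?od.
- move=> x p c IHc G sc [okp okc]; case: ifP => pk; last exact: IHc (scoped_all sc) okc.
  (* The core stops at a hypothesis on [k]; by acyclicity no goal below it is on [k]. *)
  by have [_ /(_ pk) e] := acyclic_all (scoped_acyclic sc); left; rewrite /= e.
Qed.

Lemma scoped_core G c : scoped G c -> scoped (core_ctx k G c) (core k c).
Proof.
by apply: core_descend => [{}G {}c d /scoped_and|{}G x p {}c /scoped_all].
Qed.

Lemma constraint_ok_discharge_core t G c :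
  constraint_ok G (csubst t (discharge k c)) ->
  constraint_ok (core_ctx k G c) (csubst t (discharge k (core k c))).
Proof.
apply: (@core_descend S K k (fun G c => constraint_ok G (csubst t (discharge k c)))).
  by [].
by move=> {}G x p {}c [].
Qed.

Lemma cground_discharge_core t c :
  cground (csubst t (discharge k c)) ->
  cground (csubst t (discharge k (core k c))).
Proof.
apply: (@core_descend S K k (fun _ c => cground (csubst t (discharge k c))) [::]).
  by move=> _ {}c d /andP.
by move=> _ x p {}c /andP[].
Qed.

(** Outside the core [k] does not occur and the two assignments agree; inside it the context only
    grows, so [q] stays well-scoped. *)
Lemma constraint_ok_transfer s t q G c :
  agree_off k s t -> t k = Some q -> pred_ok (args k ++ core_ctx k G c) q ->
  scoped G c -> constraint_ok G (csubst s (discharge k c)) ->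
  constraint_ok G (csubst t c).
Proof.
move=> st tk okq sc okc.
have scc := scoped_core sc; have okcc := constraint_ok_discharge_core okc.
pose Q G c := constraint_ok G (csubst s (discharge k c)) ->
  constraint_ok G (csubst t c).
have : Q G c; last exact.
apply: (@core_lift S K k Q) => [{sc okc okq scc okcc}G {}c nk|||_].
- by rewrite /Q discharge_id // (csubst_off st nk).
- by move=> {sc okc okq scc okcc}G {}c d Qc Qd [/Qc ? /Qd ?].
- by move=> {sc okc okq scc okcc}G x p {}c /(psubst_off st) e Qc [+ /Qc]; rewrite /= e.
- by apply: (constraint_ok_reassign st tk okq) okcc => //;
    [apply: scoped_nnf scc|apply: scoped_ok scc].
Qed.

End Elimination.

Theorem theorem5p9 (S : signature) (T : theory S) (R : formula S -> Prop)
    (hR : refinement_set R) (K : refinement_vars S) (c : constraint K) (k : K) :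
  nnf_constraint R c -> acyclic k c ->
  (satisfiable T R (elim1 k c) <-> satisfiable T R c).
Proof.
move=> [nc okc uc ac] acy.
have sc : scoped R k [::] c.
  by split=> // x k'; rewrite cats0; apply: ac.
have scc := scoped_core sc.
set G0 := core_ctx k [::] c in scc; set c0 := core k c in scc.
have elimE s : csubst s (elim1 k c) =
    csubst (reassign k s (psubst s (sol k c0))) (discharge k c).
  by rewrite /elim1 /scoped_sol strip_scope (csubst_elim _ _ _ nc).
(* By acyclicity the solution does not mention [k], so the value of [k] cannot affect its
   instance. *)
have solE s t : agree_off k s t -> psubst s (sol k c0) = psubst t (sol k c0).
  by move=> st; apply/(psubst_off st)/sol_noocc/(scoped_acyclic scc).
split=> -[s hs [/cgroundP gs oks vs]].
- rewrite elimE in gs oks vs; set t := reassign _ _ _ in gs oks vs.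
  have st : agree_off k s t by move=> k' h; rewrite /t reassign_off.
  have okc0 := constraint_ok_discharge_core oks.
  have [f [Rf okf ef]] := sol_expressible hR hs st scc (cground_discharge_core gs).
  (* The value of [t] at [k] need not be a refinement; [s'] replaces it by the equivalent [f]. *)
  pose s' := reassign k s (pRef K f).
  have ts' : agree_off k t s' by move=> k' h; rewrite -st // /s' reassign_off.
  have s'k : s' k = Some (pRef K f) by apply: reassign_eq.
  have tk : t k = Some (psubst s (sol k c0)) by apply: reassign_eq.
  have okF : pred_ok (args k ++ G0) (pRef K f).
    apply: okf; apply: (sol_ok st (scoped_acyclic scc) _ (scoped_ok scc) okc0).
    by [].
  exists s'.
    move=> k' p; rewrite /s' /reassign; case: eqP => [_ [<-]|_ /hs //].
    by exists f.
  split.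
  + by apply/cgroundP; apply: (cground_reassign ts' s'k _ gs).
  + exact: (constraint_ok_transfer ts' s'k okF sc oks).
  + move=> M TM rho ok; have {vs} := vs M TM rho ok.
    pose Q (G : seq (var S)) d := forall rho : env M, env_ok rho ->
      cholds rho (csubst t (discharge k d)) -> cholds rho (csubst s' d).
    suff : Q [::] c by apply.
    apply: (@core_lift S K k Q) => [G d nk|G d1 d2 Q1 Q2 r okr [/(Q1 _ okr) h /(Q2 _ okr)]||] //.
    * by move=> r _; rewrite discharge_id // (csubst_off ts' nk).
    * move=> G x p d nk Qd r okr /= h v vx; rewrite -(psubst_off ts' nk) => hp.
      by apply: Qd; [apply: env_ok_upd|apply: h].
    * move=> r okr; apply: (cholds_of_discharge ts' tk s'k _ scc okc0 okr).
        by move=> r' okr' /(ef _ _ okr').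
      by move=> r' okr' _; rewrite -(solE _ _ st) => /(ef _ _ okr').
(* Conversely, [s] itself satisfies the eliminated constraint; [t] is the merged assignment of
   [elimE]. *)
- exists s => //; rewrite /satisfies elimE; set t := reassign _ _ _.
  have ts : agree_off k t s by apply: reassign_off.
  have st : agree_off k s t by move=> k' /ts.
  have tk : t k = Some (psubst s (sol k c0)) by apply: reassign_eq.
  have ss : agree_off k s s by [].
  have gd := cground_discharge k gs.
  have okd := constraint_ok_discharge k oks.
  have okq : pred_ok (args k ++ G0) (psubst s (sol k c0)).
    by apply: (sol_ok ss (scoped_acyclic scc) _ (scoped_ok scc)
      (constraint_ok_discharge_core okd)).
  split.
  + apply/cgroundP; apply: cground_discharge; apply: (cground_reassign st tk _ gd).
    exact: (sol_ground ss (scoped_acyclic scc) (cground_discharge_core gd)).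
  + by apply: constraint_ok_discharge; apply: (constraint_ok_transfer st tk okq sc okd).
  + move=> M TM rho ok; have {vs} := vs M TM rho ok.
    (* If [s] leaves [k] unassigned, [k] does not occur in [c] and there is nothing to eliminate. *)
    case sk: (s k) => [q'|]; last first.
      have nk := cocc_unassigned sk gs.
      by rewrite discharge_id // (csubst_off ts nk).
    (* Well-sortedness is carried along because [pholds_sol_strongest] needs it at the core. *)
    pose Q (G : seq (var S)) d := constraint_ok G (csubst s d) ->
      forall rho : env M, cholds rho (csubst s d) ->
      cholds rho (csubst t (discharge k d)).
    suff h : Q [::] c by apply: h.
    apply: (@core_lift S K k Q) => [G d nk|G d1 d2 Q1 Q2 [o1 o2] r [/(Q1 o1) h /(Q2 o2)]||] //.
    * by move=> _ r; rewrite discharge_id // (csubst_off ts nk).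
    * move=> G x p d nk Qd [_ o] r /= h v vx; rewrite (psubst_off ts nk) => hp.
      by apply: Qd => //; apply: h.
    * move=> ok0 r hr.
      have [f _ ef] := hs _ _ sk; rewrite ef in sk.
      have sub0 : {subset G0 <= G0} by [].
      apply: (cholds_discharge ts tk sk sub0 scc _ hr) => r' e.
      (* Either the solution is false and the implication vacuous, or [s k] is well-sorted at the
         core. *)
      case: (core_scope sk sc oks) => [-> //|okf].
      exact: (pholds_sol_strongest sk okf sub0 scc ok0 e hr).
Qed.
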